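(* Let $X$ be an extended metric space, let $n\ge 0$ and let $\ell\in[0,\infty)$. If $MH_{n,\ell}(X)=0=MH_{n+1,\ell}(X)$, then the canonical map $PH_n(X)(\ell^-)\to PH_n(X)(\ell)$ is an isomorphism. For $X$ finite and $\mathbb{F}$ a field, every bar of the barcode of $PH_n(X;\mathbb{F})$ is an interval of the form $[b,b')$ or $[b,\infty)$, and every birth and every death in this barcode lies in $$\{\ell\mid MH_{n,\ell}(X;\mathbb{F})\neq 0\}\cup\{\ell\mid MH_{n+1,\ell}(X;\mathbb{F})\neq 0\}.$$
   Context: An extended metric space $X$ is a set $\mathrm{Ob}\,X$ with $d\colon \mathrm{Ob}\,X\times \mathrm{Ob}\,X\to[0,\infty]$ such that $d(x,x)=0$, $d(x,y)=d(y,x)$, $d(x,z)\le d(x,y)+d(y,z)$, and $d(x,y)=0$ implies $x=y$. It is finite when $\mathrm{Ob}\,X$ is finite. The length nerve $N(X)$ is the simplicial set with $N(X)_n$ the set of all maps $[n]\to\mathrm{Ob}\,X$, written $\mathbf{x}=\langle x_0,\dots,x_n\rangle$; the face $d_i$ deletes the entry $x_i$ and the degeneracy $s_i$ repeats it. The length is $\lambda\mathbf{x}=\sum_{i=1}^n d(x_{i-1},x_i)\in[0,\infty]$. The normalised chain complex $C_\bullet(X)$ has $C_n(X)=\mathbb{Z}[N(X)_n]/D_n(X)$, with $D_n(X)$ spanned by the degenerate simplices and differential $\partial=\sum_{i=0}^n(-1)^i d_i$; $C_n(X)$ is free on the nondegenerate tuples ($x_{i-1}\ne x_i$ for all $i$).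 For $\ell\in[0,\infty)$, $F_\ell C_n(X)\subseteq C_n(X)$ is spanned by the nondegenerate tuples with $\lambda\mathbf{x}\le\ell$; these form subcomplexes increasing in $\ell$. Persistent magnitude homology is the functor $PH_n(X)\colon([0,\infty),\le)\to\mathsf{Ab}$, $\ell\mapsto H_n(F_\ell C_\bullet(X))$, with transition maps induced by inclusions. $PH_n(X)(\ell^-)=\operatorname{colim}_{\ell'<\ell}PH_n(X)(\ell')$ (zero for $\ell=0$), and the canonical map to $PH_n(X)(\ell)$ is induced by the transition maps. Put $F_{<\ell}C_\bullet(X)=\bigcup_{\ell'<\ell}F_{\ell'}C_\bullet(X)$, $MC_{\bullet,\ell}(X)=F_\ell C_\bullet(X)/F_{<\ell}C_\bullet(X)$, $MH_{n,\ell}(X)=H_n(MC_{\bullet,\ell}(X))$. For a field $\mathbb{F}$, $PH_n(X;\mathbb{F})(\ell)=H_n(F_\ell C_\bullet(X)\otimes_{\mathbb{Z}}\mathbb{F})$ and $MH_{n,\ell}(X;\mathbb{F})=H_n(MC_{\bullet,\ell}(X)\otimes_{\mathbb{Z}}\mathbb{F})$. An interval is a nonempty order-convex $J\subseteq[0,\infty)$; the interval module $\mathbb{F}_J$ is $\mathbb{F}$ on $J$ and $0$ elsewhere, with identity transition maps between nonzero terms. A functor $M\colon([0,\infty),\le)\to\mathsf{Vect}_{\mathbb{F}}$ with all $\dim M\ell<\infty$ is isomorphic to $\bigoplus_{J\in\mathcal{B}}\mathbb{F}_J$ for a multiset $\mathcal{B}$ of intervals, unique up to bijection (known theorem); $\mathcal{B}$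 is its barcode and its elements are the bars. A birth is $\inf J$ for a bar $J$; a death is $\sup J$ for a bar $J$ when $\sup J$ is finite. For finite $X$ the module $PH_n(X;\mathbb{F})$ is pointwise finite-dimensional. *)

(* Defs.v *)
From HB Require Import structures.
From mathcomp Require Import all_boot all_order all_algebra.
From mathcomp Require Import interval_inference finmap all_classical all_reals.
From mathcomp Require Import zify.
(* The notations of monalg clash with those of classical. *)
From mathcomp Require Import -(notations) monalg.

Set Implicit Arguments.
Unset Strict Implicit.
Unset Printing Implicit Defensive.

Import Order.TTheory GRing.Theory Num.Theory.

Local Open Scope classical_set_scope.
Local Open Scope ring_scope.

Definition is_trivial (V : zmodType) : Prop := forall v : V, v = 0.

Record submod (k : nzRingType) (V : lmodType k) := Submod {
  submod_pred :> {pred V};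
  submod_axiom : submod_closed submod_pred }.

HB.instance Definition _ (k : nzRingType) (V : lmodType k) (S : submod V) :=
  GRing.isSubmodClosed.Build k V (submod_pred S)
    (GRing.submod_closed_semi (submod_axiom S)).

Record subm (k : nzRingType) (V : lmodType k) (S : submod V) := Subm {
  subm_val : V;
  subm_valP : subm_val \in S }.

Section SubModule.
Variables (k : nzRingType) (V : lmodType k) (S : submod V).
HB.instance Definition _ := [isSub for @subm_val k V S].
HB.instance Definition _ := [Choice of subm S by <:].
HB.instance Definition _ := [SubChoice_isSubLmodule of subm S by <:].

Lemma subm_val_linear : linear (@subm_val k V S).
Proof. by []. Qed.
HB.instance Definition _ :=
  GRing.isLinear.Build k (subm S) V *:%R (@subm_val k V S) subm_val_linear.
End SubModule.

Section SubmoduleConstructions.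
Variables (k : nzRingType) (V W : lmodType k).

Lemma predT_closed : submod_closed (fun _ : V => true).
Proof. by []. Qed.
Definition full_submod : submod V := Submod predT_closed.

Lemma lspan_closed (G : set V) :
  submod_closed (fun v => `[< forall S : submod V, (forall g, G g -> g \in S) -> v \in S >]).
Proof.
split; first by apply/asboolP => S _; exact: rpred0.
move=> a u v /asboolP uG /asboolP vG; apply/asboolP => S GS.
by rewrite rpredD ?rpredZ ?uG ?vG.
Qed.

(* The smallest submodule containing [G]. *)
Definition lspan (G : set V) : submod V := Submod (lspan_closed G).

Lemma kerm_closed (f : {linear V -> W}) : submod_closed (fun v => f v == 0).
Proof.
split; first by rewrite unfold_in linear0.
by move=> a u v; rewrite !unfold_in linearP => /eqP-> /eqP->; rewrite scaler0 addr0.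
Qed.
Definition kerm (f : {linear V -> W}) : submod V := Submod (kerm_closed f).

Lemma imm_closed (f : {linear V -> W}) :
  submod_closed (fun w => `[< exists v, w = f v >]).
Proof.
split; first by apply/asboolP; exists 0; rewrite linear0.
move=> a u v /asboolP[x ->] /asboolP[y ->]; apply/asboolP.
by exists (a *: x + y); rewrite linearP.
Qed.
Definition imm (f : {linear V -> W}) : submod W := Submod (imm_closed f).

Lemma preimm_closed (f : {linear V -> W}) (S : submod W) :
  submod_closed (fun v => f v \in S).
Proof.
split; first by change (f 0 \in S); rewrite linear0 rpred0.
move=> a u v uS vS; change (f (a *: u + v) \in S).
by rewrite linearP rpredD ?rpredZ.
Qed.
Definition preimm (f : {linear V -> W}) (S : submod W) : submod V :=
  Submod (preimm_closed f S).

Lemma mem_preimm (f : {linear V -> W}) (S : submod W) v :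
  (v \in preimm f S) = (f v \in S).
Proof. by []. Qed.

End SubmoduleConstructions.

Definition quotm (k : nzRingType) (V : lmodType k) (S : submod V) : Type :=
  {ideal_quot (submod_pred S)}.

Section QuotientModule.
Local Open Scope quotient_scope.
Variables (k : nzRingType) (V : lmodType k) (S : submod V).

HB.instance Definition _ := GRing.Zmodule.on (quotm S).

Definition qpi (v : V) : quotm S := \pi_({ideal_quot (submod_pred S)}) v.

Lemma qpiP u v : (qpi u = qpi v) <-> (u - v \in S).
Proof.
by rewrite Quotient.idealrBE; split => [/eqP|/eqP].
Qed.

Lemma qpi_surj (x : quotm S) : exists v, x = qpi v.
Proof. by exists (repr x); rewrite /qpi reprK. Qed.

Lemma qpi_additive : zmod_morphism qpi.
Proof. by move=> u v; rewrite /qpi raddfB. Qed.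

Definition qscale (a : k) (x : quotm S) : quotm S :=
  qpi (a *: (repr x : V)).

Lemma qscaleE a v : qscale a (qpi v) = qpi (a *: v).
Proof.
apply/qpiP; rewrite -scalerBr rpredZ//; apply/qpiP.
by rewrite /qpi reprK.
Qed.

Fact qpiD u v : qpi (u + v) = qpi u + qpi v.
Proof. by rewrite /qpi raddfD. Qed.

Lemma qscaleA a b x : qscale a (qscale b x) = qscale (a * b) x.
Proof. by have [v ->] := qpi_surj x; rewrite !qscaleE scalerA. Qed.
Lemma qscale1 : left_id 1 qscale.
Proof. by move=> x; have [v ->] := qpi_surj x; rewrite qscaleE scale1r. Qed.
Lemma qscaleDr : right_distributive qscale +%R.
Proof.
move=> a x y; have [u ->] := qpi_surj x; have [v ->] := qpi_surj y.
by rewrite -qpiD !qscaleE scalerDr qpiD.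
Qed.
Lemma qscaleDl x : {morph qscale^~ x : a b / a + b}.
Proof.
by move=> a b; have [u ->] := qpi_surj x; rewrite !qscaleE scalerDl qpiD.
Qed.
HB.instance Definition _ := GRing.Zmodule_isLmodule.Build k (quotm S)
  qscaleA qscale1 qscaleDr qscaleDl.

Lemma qpi_linear : linear qpi.
Proof. by move=> a u v; rewrite qpiD -qscaleE. Qed.
HB.instance Definition _ := GRing.isLinear.Build k V (quotm S) *:%R qpi qpi_linear.

Lemma qpi0 v : v \in S -> qpi v = 0.
Proof.
by move=> vS; rewrite -(linear0 qpi); apply/qpiP; rewrite subr0.
Qed.

Variables (W : lmodType k) (g : {linear V -> W}).
Definition qlift (gS : forall v, v \in S -> g v = 0) (x : quotm S) : W :=
  g (repr x).
Hypothesis gS : forall v, v \in S -> g v = 0.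

Lemma qliftE v : qlift gS (qpi v) = g v.
Proof.
apply/eqP; rewrite -subr_eq0 -linearB; apply/eqP/gS/qpiP.
by rewrite /qpi reprK.
Qed.
Lemma qlift_linear : linear (qlift gS).
Proof.
move=> a x y; have [u ->] := qpi_surj x; have [v ->] := qpi_surj y.
by rewrite -linearP !qliftE linearP.
Qed.
HB.instance Definition _ := GRing.isLinear.Build k (quotm S) W *:%R (qlift gS) qlift_linear.

End QuotientModule.
Arguments qpi {k V} S v.

Section ModuleMaps.
Variables (k : nzRingType) (V W : lmodType k).

Definition qmap (S : submod V) (T : submod W) (f : {linear V -> W})
    (fS : forall v, v \in S -> f v \in T) : {linear quotm S -> quotm T} :=
  @qlift k V S (quotm T) (qpi T \o f) (fun v vS => qpi0 (fS v vS)).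

Lemma qmapE (S : submod V) (T : submod W) (f : {linear V -> W})
    (fS : forall v, v \in S -> f v \in T) v :
  qmap fS (qpi S v) = qpi T (f v).
Proof. exact: (@qliftE k V S (quotm T) (qpi T \o f)). Qed.

Definition smap (S : submod V) (T : submod W) (f : {linear V -> W})
    (fS : forall v, v \in S -> f v \in T) (x : subm S) : subm T :=
  Subm (fS (subm_val x) (subm_valP x)).

Lemma smap_linear (S : submod V) (T : submod W) (f : {linear V -> W})
  (fS : forall v, v \in S -> f v \in T) : linear (smap fS).
Proof. by move=> a x y; apply: val_inj; rewrite /= !linearP. Qed.
HB.instance Definition _ S T f fS :=
  GRing.isLinear.Build k (subm S) (subm T) *:%R (@smap S T f fS) (smap_linear fS).

End ModuleMaps.

Section FreeModule.
Variables (k : nzRingType) (K : choiceType) (V : lmodType k).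

(* The linear extension of [h] to the free module [malg K k] on the set [K]. *)
Definition malg_lift (h : K -> V) (g : malg K k) : V :=
  \sum_(x <- msupp g) mcoeff x g *: h x.

Lemma malg_liftEw (h : K -> V) (g : malg K k) (d : {fset K}) :
  (msupp g `<=` d)%fset ->
  malg_lift h g = \sum_(x <- d) mcoeff x g *: h x.
Proof.
move=> gd; rewrite /malg_lift (big_fset_incl _ gd)// => x _ xg.
by rewrite mcoeff_outdom// scale0r.
Qed.

Lemma malg_lift_linear (h : K -> V) : linear (malg_lift h).
Proof.
move=> a u v; pose d := (msupp u `|` msupp v)%fset.
have ud : (msupp u `<=` d)%fset by exact: fsubsetUl.
have vd : (msupp v `<=` d)%fset by exact: fsubsetUr.
have uvd : (msupp (a *: u + v) `<=` d)%fset.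
  apply: (fsubset_trans (msuppD_le _ _)); rewrite fsubUset vd andbT.
  exact: (fsubset_trans (msuppZ_le _ _)).
rewrite (malg_liftEw _ ud) (malg_liftEw _ vd) (malg_liftEw _ uvd).
rewrite scaler_sumr -big_split /=; apply: eq_bigr => x _.
by rewrite mcoeffD mcoeffZ scalerDl scalerA.
Qed.
HB.instance Definition _ h :=
  GRing.isLinear.Build k (malg K k) V *:%R (malg_lift h) (malg_lift_linear h).

Lemma malg_liftU (h : K -> V) x : malg_lift h (mkmalgU x 1) = h x.
Proof.
by rewrite /malg_lift msuppU oner_eq0 big_seq_fset1 mcoeffUU scale1r.
Qed.

Lemma malg_ext (f g : {linear malg K k -> V}) :
  (forall x, f (mkmalgU x 1) = g (mkmalgU x 1)) -> f =1 g.
Proof.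
move=> fg u; rewrite (monalgE u) !linear_sum; apply: eq_bigr => x _.
have -> : mkmalgU x (mcoeff x u) = mcoeff x u *: mkmalgU x 1 :> malg K k.
  by apply/malgP => y; rewrite mcoeffZ !mcoeffU mulrnAr mulr1.
by rewrite !linearZ/= fg.
Qed.
End FreeModule.

Section BaseChange.
Variable k : nzRingType.

(* [tensor A] is the tensor product of the abelian group [A] with [k] over the
   integers, as a [k]-module: formal sums of the symbols [a (x) c], represented
   by [mkmalgU a c] and additive in [c] by construction, modulo additivity
   in [a]. *)
Definition tensor_rel (A : lmodType int) : set (malg A k) :=
  [set u | exists a b, u = mkmalgU (a + b) 1 - mkmalgU a 1 - mkmalgU b 1].

Definition tensor (A : lmodType int) : lmodType k :=
  quotm (lspan (@tensor_rel A)).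

Lemma lspan_gen (V : lmodType k) (G : set V) g : G g -> g \in lspan G.
Proof. by move=> Gg; apply/asboolP => S; exact. Qed.

Lemma lspan_sub (V : lmodType k) (G : set V) (S : submod V) :
  (forall g, G g -> g \in S) -> forall v, v \in lspan G -> v \in S.
Proof. by move=> GS v /asboolP; exact. Qed.

Definition tensor_fun (A B : lmodType int) (f : {linear A -> B}) :
    {linear malg A k -> malg B k} :=
  malg_lift (fun a => mkmalgU (f a) 1).

Lemma tensor_fun_rel (A B : lmodType int) (f : {linear A -> B}) v :
  v \in lspan (@tensor_rel A) -> tensor_fun f v \in lspan (@tensor_rel B).
Proof.
pose S := preimm (tensor_fun f) (lspan (@tensor_rel B)).
apply: (@lspan_sub _ _ S) => _ [a [b ->]].
rewrite mem_preimm.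
rewrite !linearB /= !malg_liftU; apply: lspan_gen.
by exists (f a), (f b); rewrite linearD.
Qed.

Definition tensor_map (A B : lmodType int) (f : {linear A -> B}) :
    {linear tensor A -> tensor B} := qmap (@tensor_fun_rel A B f).

Lemma tensor_ext (A : lmodType int) (V : lmodType k)
    (f g : {linear tensor A -> V}) :
  (forall a, f (qpi _ (mkmalgU a 1)) = g (qpi _ (mkmalgU a 1))) -> f =1 g.
Proof.
move=> fg x; have [v ->] := qpi_surj x.
by apply: (@malg_ext _ _ _ (f \o qpi _) (g \o qpi _)).
Qed.

Lemma tensor_mapE (A B : lmodType int) (f : {linear A -> B}) a :
  tensor_map f (qpi _ (mkmalgU a 1)) = qpi _ (mkmalgU (f a) 1).
Proof. by rewrite qmapE /= malg_liftU. Qed.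

Lemma tensor_map_id (A : lmodType int) (f : {linear A -> A}) :
  f =1 id -> tensor_map f =1 id.
Proof.
move=> f1; apply: (@tensor_ext _ _ _ idfun) => a.
by rewrite tensor_mapE f1.
Qed.

Lemma tensor_map_comp (A B C : lmodType int) (f : {linear A -> B})
    (g : {linear B -> C}) (h : {linear A -> C}) :
  (forall a, h a = g (f a)) ->
  forall x, tensor_map h x = tensor_map g (tensor_map f x).
Proof.
move=> hgf; apply: (@tensor_ext _ _ _ (tensor_map g \o tensor_map f)) => a.
rewrite tensor_mapE hgf; apply/esym.
exact: (etrans (congr1 _ (tensor_mapE _ _)) (tensor_mapE _ _)).
Qed.

Lemma tensor_map_zero (A B : lmodType int) (f : {linear A -> B}) :
  (forall a, f a = 0) -> forall x, tensor_map f x = 0.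
Proof.
move=> f0; apply: (@tensor_ext _ _ _ \0) => a.
rewrite tensor_mapE f0 /=; apply: qpi0.
rewrite -[X in X \in _]opprK rpredN; apply: lspan_gen.
by exists 0, 0; rewrite addr0 subrr sub0r.
Qed.
End BaseChange.

Section DirectSum.
Variables (k : nzRingType) (I : choiceType).

Definition dprod (V : I -> lmodType k) : Type := forall i, V i.

Section Dprod.
Variable V : I -> lmodType k.
HB.instance Definition _ := gen_eqMixin (dprod V).
HB.instance Definition _ := gen_choiceMixin (dprod V).

Let add (x y : dprod V) : dprod V := fun i => x i + y i.
Let opp (x : dprod V) : dprod V := fun i => - x i.
Let zero : dprod V := fun i => 0.
Let scale (a : k) (x : dprod V) : dprod V := fun i => a *: x i.

Let addA : associative add.
Proof. by move=> x y z; apply: functional_extensionality_dep => i; rewrite /add addrA. Qed.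
Let addC : commutative add.
Proof. by move=> x y; apply: functional_extensionality_dep => i; rewrite /add addrC. Qed.
Let add0 : left_id zero add.
Proof. by move=> x; apply: functional_extensionality_dep => i; rewrite /add add0r. Qed.
Let addN : left_inverse zero opp add.
Proof. by move=> x; apply: functional_extensionality_dep => i; rewrite /add addNr. Qed.
HB.instance Definition _ := GRing.isZmodule.Build (dprod V) addA addC add0 addN.

Let scaleA a b x : scale a (scale b x) = scale (a * b) x.
Proof. by apply: functional_extensionality_dep => i; rewrite /scale scalerA. Qed.
Let scale1 : left_id 1 scale.
Proof. by move=> x; apply: functional_extensionality_dep => i; rewrite /scale scale1r. Qed.
Let scaleDr : right_distributive scale +%R.
Proof. by move=> a x y; apply: functional_extensionality_dep => i; rewrite /scale scalerDr. Qed.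
Let scaleDl x : {morph scale^~ x : a b / a + b}.
Proof. by move=> a b; apply: functional_extensionality_dep => i; rewrite /scale scalerDl. Qed.
HB.instance Definition _ := GRing.Zmodule_isLmodule.Build k (dprod V)
  scaleA scale1 scaleDr scaleDl.

Lemma finsupp_closed :
  submod_closed (fun x : dprod V => `[< finite_set [set i | x i != 0] >]).
Proof.
split.
  apply/asboolP; rewrite (_ : mkset _ = set0)//.
  by apply/seteqP; split => // i /=; rewrite eqxx.
move=> a x y /asboolP fx /asboolP fy; apply/asboolP.
have fxy : finite_set ([set i | x i != 0] `|` [set i | y i != 0]).
  by rewrite finite_setU.
apply: sub_finite_set fxy => i /= axy; rewrite /setU /=.
have [xi|] := eqVneq (x i) 0; last by left.
have [yi|] := eqVneq (y i) 0; last by right.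
move: axy; rewrite [X in X != 0](_ : _ = a *: x i + y i)//.
by rewrite xi yi scaler0 addr0 eqxx.
Qed.

Definition dsum : lmodType k := subm (Submod finsupp_closed).

Definition dsum_fun (x : dsum) : forall i, V i := subm_val x.

Lemma dsum_fun_finite (x : dsum) : finite_set [set i | dsum_fun x i != 0].
Proof. exact/asboolP/(subm_valP x). Qed.

End Dprod.
End DirectSum.

Section DirectSumMaps.
Variables (k : nzRingType) (I : choiceType).

Definition dprod_map (V W : I -> lmodType k) (f : forall i, {linear V i -> W i})
  (x : dprod V) : dprod W := fun i => f i (x i).

Lemma dprod_map_linear V W f : linear (@dprod_map V W f).
Proof.
by move=> a x y; apply: functional_extensionality_dep => i; exact: linearP.
Qed.
HB.instance Definition _ (V W : I -> lmodType k)
    (f : forall i, {linear V i -> W i}) := GRing.isLinear.Build k (dprod V) (dprod W)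
  *:%R (@dprod_map V W f) (@dprod_map_linear V W f).

Lemma dprod_map_finsupp V W f x : x \in Submod (finsupp_closed V) ->
  @dprod_map V W f x \in Submod (finsupp_closed W).
Proof.
move=> /asboolP fx; apply/asboolP; apply: sub_finite_set fx => i /=.
by apply: contraNN => /eqP xi; rewrite /dprod_map xi linear0.
Qed.

Definition dsum_map (V W : I -> lmodType k) (f : forall i, {linear V i -> W i}) :
    {linear dsum V -> dsum W} := smap (@dprod_map_finsupp V W f).

Definition dprod_inj (V : I -> lmodType k) (i : I) (v : V i) : dprod V :=
  fun j => if i =P j is ReflectT ij then ecast j (V j) ij v else 0.

Lemma dprod_inj_finsupp V i v :
  @dprod_inj V i v \in Submod (finsupp_closed V).
Proof.
apply/asboolP; apply: (@sub_finite_set _ _ [set i]); last exact: finite_set1.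
by move=> j; rewrite /= /dprod_inj; case: eqP => //= _; rewrite eqxx.
Qed.

Definition dsum_inj (V : I -> lmodType k) (i : I) (v : V i) : dsum V :=
  Subm (dprod_inj_finsupp v).

Definition dsum_lift (V : I -> lmodType k) (W : lmodType k)
    (f : forall i, {linear V i -> W}) (x : dsum V) : W :=
  \sum_(i \in [set: I]) f i (dsum_fun x i).

Lemma dsum_liftE V W f (x : dsum V) (d : {fset I}) :
  (forall i, dsum_fun x i != 0 -> i \in d) ->
  @dsum_lift V W f x = \sum_(i <- d) f i (dsum_fun x i).
Proof.
move=> xd; apply: fsbigTE => i id; have [->|xi] := eqVneq (dsum_fun x i) 0.
  by rewrite linear0.
by rewrite xd in id.
Qed.

Lemma dsum_lift_linear (V : I -> lmodType k) (W : lmodType k)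
    (f : forall i, {linear V i -> W}) : linear (@dsum_lift V W f).
Proof.
move=> a x y; have fx := dsum_fun_finite x; have fy := dsum_fun_finite y.
pose d := (fset_set [set i | dsum_fun x i != 0] `|`
           fset_set [set i | dsum_fun y i != 0])%fset.
have xd i : dsum_fun x i != 0 -> i \in d.
  by move=> xi; rewrite in_fsetU in_fset_set// mem_set.
have yd i : dsum_fun y i != 0 -> i \in d.
  by move=> yi; rewrite in_fsetU orbC in_fset_set// mem_set.
have axyE i : dsum_fun (a *: x + y) i = a *: dsum_fun x i + dsum_fun y i by [].
have axyd i : dsum_fun (a *: x + y) i != 0 -> i \in d.
  rewrite axyE; apply: contraNT => id.
  have /eqP -> : dsum_fun x i == 0 by apply: contraNT id; exact: xd.
  have /eqP -> : dsum_fun y i == 0 by apply: contraNT id; exact: yd.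
  by rewrite scaler0 addr0.
rewrite (dsum_liftE _ xd) (dsum_liftE _ yd) (dsum_liftE _ axyd).
rewrite scaler_sumr -big_split; apply: eq_bigr => i _.
by rewrite axyE linearP.
Qed.
HB.instance Definition _ (V : I -> lmodType k) (W : lmodType k)
    (f : forall i, {linear V i -> W}) := GRing.isLinear.Build k (dsum V) W
  *:%R (@dsum_lift V W f) (@dsum_lift_linear V W f).

Lemma dsum_lift_inj V W f i v : @dsum_lift V W f (dsum_inj v) = f i v.
Proof.
rewrite (@dsum_liftE _ _ _ _ [fset i]%fset).
  rewrite big_seq_fset1 /dsum_fun /= /dprod_inj; case: eqP => // ii.
  by rewrite (Prop_irrelevance ii erefl).
by move=> j; rewrite inE /dsum_fun /= /dprod_inj; case: eqP => [ij _|_]; rewrite ?eqxx// -ij.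
Qed.
End DirectSumMaps.

Record complex (k : nzRingType) := Complex {
  cx_ob :> nat -> lmodType k;
  bd : forall n, {linear cx_ob n.+1 -> cx_ob n};
  bdK : forall n x, bd n (bd n.+1 x) = 0 }.
Arguments bd {k} c n.

Record chain_map (k : nzRingType) (C D : complex k) := ChainMap {
  cmap :> forall n, {linear C n -> D n};
  cmapK : forall n x, cmap n (bd C n x) = bd D n (cmap n.+1 x) }.

Section Homology.
Variable k : nzRingType.

Definition cycles (C : complex k) (n : nat) : submod (C n) :=
  match n with
  | 0 => full_submod (C 0)
  | m.+1 => kerm (bd C m)
  end.

Definition boundaries (C : complex k) (n : nat) : submod (C n) := imm (bd C n).

Definition homology (C : complex k) (n : nat) : lmodType k :=
  quotm (preimm (@subm_val k (C n) (cycles C n)) (boundaries C n)).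

Variables (C D : complex k) (f : chain_map C D) (n : nat).

Lemma cmap_cycles v : v \in cycles C n -> f n v \in cycles D n.
Proof.
case: n v => [//|m] v /eqP vC; apply/eqP.
by rewrite -cmapK vC linear0.
Qed.

Definition cycles_map : {linear subm (cycles C n) -> subm (cycles D n)} :=
  smap cmap_cycles.

Lemma cmap_boundaries v :
  v \in preimm (@subm_val k (C n) (cycles C n)) (boundaries C n) ->
  cycles_map v \in preimm (@subm_val k (D n) (cycles D n)) (boundaries D n).
Proof.
move=> /asboolP[x vx]; apply/asboolP; exists (f n.+1 x).
by rewrite -cmapK -vx.
Qed.

Definition homology_map : {linear homology C n -> homology D n} :=
  qmap cmap_boundaries.

Lemma homology_mapE v : homology_map (qpi _ v) = qpi _ (cycles_map v).
Proof. exact: qmapE. Qed.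
End Homology.

Section HomologyFunctor.
Variable k : nzRingType.

Lemma homology_map_id (C : complex k) (f : chain_map C C) n :
  f n =1 id -> homology_map f n =1 id.
Proof.
move=> f1 x; have [v ->] := qpi_surj x; rewrite qmapE; congr (qpi _ _).
by apply: val_inj; rewrite /= f1.
Qed.

Lemma homology_map_comp (C D E : complex k) (f : chain_map C D)
    (g : chain_map D E) (h : chain_map C E) n :
  (forall x, h n x = g n (f n x)) ->
  forall x, homology_map h n x = homology_map g n (homology_map f n x).
Proof.
move=> hgf x; have [v ->] := qpi_surj x; rewrite !homology_mapE; congr (qpi _ _).
by apply: val_inj; rewrite /= hgf.
Qed.
End HomologyFunctor.

Record subcomplex (k : nzRingType) (C : complex k) := Subcomplex {
  sub_chain :> forall n, submod (C n);
  sub_bd : forall n x, x \in sub_chain n.+1 -> bd C n x \in sub_chain n }.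

Section Subcomplex.
Variables (k : nzRingType) (C : complex k).

Section Complex.
Variable A : subcomplex C.

Definition subcx_bd n : {linear subm (A n.+1) -> subm (A n)} := smap (@sub_bd k C A n).

Lemma subcx_bdK n x : subcx_bd n (subcx_bd n.+1 x) = 0.
Proof. by apply: val_inj; rewrite /= bdK. Qed.

Definition subcx : complex k := Complex subcx_bdK.

Definition quotcx_bd n : {linear quotm (A n.+1) -> quotm (A n)} :=
  qmap (@sub_bd k C A n).

Lemma quotcx_bdK n x : quotcx_bd n (quotcx_bd n.+1 x) = 0.
Proof.
have [v ->] := qpi_surj x; rewrite /quotcx_bd !qmapE bdK; exact: linear0.
Qed.

Definition quotcx : complex k := Complex quotcx_bdK.
End Complex.

Section Inclusion.
Variables (A B : subcomplex C) (AB : forall n x, x \in A n -> x \in B n).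

Definition incl_map n : {linear subcx A n -> subcx B n} :=
  @smap k _ _ (A n) (B n) idfun (@AB n).

Lemma incl_mapK n x : incl_map n (bd (subcx A) n x) = bd (subcx B) n (incl_map n.+1 x).
Proof. exact: val_inj. Qed.

Definition incl : chain_map (subcx A) (subcx B) := ChainMap incl_mapK.
End Inclusion.

(* [A], meant to be contained in [B], as a subcomplex of the complex [B]. *)
Lemma restr_bd (A B : subcomplex C) n (x : subcx B n.+1) :
  x \in preimm (@subm_val k (C n.+1) (B n.+1)) (A n.+1) ->
  bd (subcx B) n x \in preimm (@subm_val k (C n) (B n)) (A n).
Proof. exact: (@sub_bd k C A n (subm_val x)). Qed.

Definition restr (A B : subcomplex C) : subcomplex (subcx B) :=
  @Subcomplex k (subcx B) (fun n => preimm (@subm_val k (C n) (B n)) (A n))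
    (@restr_bd A B).
End Subcomplex.

Section BaseChangeComplex.
Variable k : nzRingType.

Definition tensor_bd (C : complex int) n :
  {linear tensor k (C n.+1) -> tensor k (C n)} := tensor_map k (bd C n).

Lemma tensor_bdK (C : complex int) n x : tensor_bd C n (tensor_bd C n.+1 x) = 0.
Proof.
rewrite -(@tensor_map_comp _ _ _ _ _ _ (bd C n \o bd C n.+1))//.
by apply: tensor_map_zero => a /=; exact: bdK.
Qed.

Definition tensorcx (C : complex int) : complex k := Complex (@tensor_bdK C).

Variables (C D : complex int) (f : chain_map C D).

Lemma tensorcx_mapK n x :
  tensor_map k (f n) (bd (tensorcx C) n x) =
  bd (tensorcx D) n (tensor_map k (f n.+1) x).
Proof.
rewrite -(@tensor_map_comp _ _ _ _ _ _ (f n \o bd C n))//.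
by apply: tensor_map_comp => a /=; exact: cmapK.
Qed.

Definition tensorcx_map : chain_map (tensorcx C) (tensorcx D) :=
  @ChainMap k (tensorcx C) (tensorcx D) (fun n => tensor_map k (f n)) tensorcx_mapK.
End BaseChangeComplex.

Record extMetric (R : realType) := ExtMetric {
  Ob :> choiceType;
  dist : Ob -> Ob -> \bar R;
  dist_ge0 : forall x y, (0 <= dist x y)%E;
  distxx : forall x, dist x x = 0%E;
  distC : forall x y, dist x y = dist y x;
  dist_triangle : forall x y z, (dist x z <= dist x y + dist y z)%E;
  dist_eq0 : forall x y, dist x y = 0%E -> x = y }.

Section LengthNerve.
Variables (R : realType) (X : extMetric R).

Definition nerve (n : nat) : choiceType := {ffun 'I_n.+1 -> X}.

Definition face n (i : 'I_n.+2) (x : nerve n.+1) : nerve n :=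
  [ffun j => x (lift i j)].

Definition degen n (i : 'I_n.+1) (x : nerve n) : nerve n.+1 :=
  [ffun j : 'I_n.+2 => x (inord (unbump i j))].

Definition len n (x : nerve n) : \bar R :=
  (\sum_(i < n) dist (x (inord i)) (x (inord i.+1)))%E.

Definition degenerate n : set (nerve n) :=
  match n with
  | 0 => set0
  | m.+1 => [set x | exists (i : 'I_m.+1) (y : nerve m), x = degen i y]
  end.

Lemma faceE n (i : 'I_n.+2) (x : nerve n.+1) m : (m <= n)%N ->
  face i x (inord m) = x (inord (bump i m)).
Proof.
move=> mn; rewrite ffunE; congr (x _); apply: val_inj => /=.
by rewrite !inordK// /bump; lia.
Qed.

Lemma nerve_ext n (x y : nerve n) :
  (forall m, (m <= n)%N -> x (inord m) = y (inord m)) -> x = y.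
Proof.
by move=> xy; apply/ffunP => j; rewrite -(inord_val j) xy// -ltnS.
Qed.

Lemma degenerateP n (x : nerve n) :
  degenerate x <-> exists2 i, (i < n)%N & x (inord i) = x (inord i.+1).
Proof.
case: n x => [|n] x; first by split => [//|[]].
split=> [[i [y ->]]|[i ilen xi]].
  have iL := ltn_ord i; exists (nat_of_ord i) => //.
  rewrite !ffunE; congr (y (inord _)).
  by rewrite !inordK /unbump; lia.
exists (Ordinal ilen), (face (inord i.+1) x); apply: nerve_ext => m mn.
rewrite ffunE inordK ?ltnS//= faceE; last first.
  by rewrite /unbump; case: ltnP => imm; lia.
rewrite inordK ?ltnS// /unbump /bump.
have [mi|imm] := leqP m i; first by rewrite subn0 leqNgt ltnS mi.
rewrite subn1; have [->|mi] := eqVneq m i.+1.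
  by rewrite ltnn add0n xi.
rewrite (_ : _ <= _)%N//; last by lia.
by congr (x (inord _)); lia.
Qed.

Lemma len_ge0 n (x : nerve n) : (0 <= len x)%E.
Proof. by apply: sume_ge0 => i _; exact: dist_ge0. Qed.

Lemma bump_lt h m : (m < h)%N -> bump h m = m.
Proof. by rewrite /bump ltnNge => /negbTE ->. Qed.

Lemma len_face n (i : 'I_n.+2) (x : nerve n.+1) : (len (face i x) <= len x)%E.
Proof.
pose g m := x (inord m).
have -> : len (face i x) = (\sum_(m < n) dist (g (bump i m)) (g (bump i m.+1)))%E.
  by apply: eq_bigr => m _; rewrite !faceE// ltnW.
have -> : len x = (\sum_(m < n.+1) dist (g m) (g m.+1))%E by [].
have : (i <= n.+1)%N by rewrite -ltnS.
move: {x} g (nat_of_ord i) => g {}i.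
elim: n i => [|n IHn] i; first by rewrite big_ord0 sume_ge0// => *; exact: dist_ge0.
rewrite leq_eqVlt => /predU1P[->|].
  rewrite [leRHS]big_ord_recr/= -[leLHS]adde0; apply: leeD (dist_ge0 _ _).
  rewrite le_eqVlt; apply/orP; left; apply/eqP; apply: eq_bigr => m _.
  by rewrite !bump_lt//; have := ltn_ord m; lia.
rewrite ltnS leq_eqVlt => /predU1P[->|iln].
  rewrite big_ord_recr/= [leRHS]big_ord_recr/= [in leRHS]big_ord_recr/= -addeA.
  have bn : bump n.+1 n = n by rewrite /bump ltnn.
  have bn1 : bump n.+1 n.+1 = n.+2 by rewrite /bump leqnn.
  rewrite bn bn1; apply: leeD; last exact: dist_triangle.
  rewrite le_eqVlt; apply/orP; left; apply/eqP; apply: eq_bigr => m _.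
  by rewrite !bump_lt//; have := ltn_ord m; lia.
rewrite big_ord_recr/= [leRHS]big_ord_recr/=; apply: leeD; first exact/IHn/ltnW.
have bn : bump i n = n.+1 by rewrite /bump; lia.
have bn1 : bump i n.+1 = n.+2 by rewrite /bump; lia.
by rewrite bn bn1.
Qed.

Lemma face_face n (i : 'I_n.+3) (j : 'I_n.+2) (i' : 'I_n.+3) (j' : 'I_n.+2)
    (x : nerve n.+2) : (j < i)%N -> i' = j :> nat -> j' = i.-1 :> nat ->
  face j (face i x) = face j' (face i' x).
Proof.
move=> ji ei ej; apply/ffunP => m; rewrite !ffunE; congr (x _).
by apply: val_inj; rewrite /= ei ej /bump; lia.
Qed.

Definition free_bd n : {linear malg (nerve n.+1) int -> malg (nerve n) int} :=
  malg_lift (fun x => \sum_(i < n.+2) (-1) ^+ i *: mkmalgU (face i x) 1).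

Lemma free_bdU n (x : nerve n.+1) :
  free_bd n (mkmalgU x 1) = \sum_(i < n.+2) (-1) ^+ i *: mkmalgU (face i x) 1.
Proof. exact: malg_liftU. Qed.

Lemma free_bdK n u : free_bd n (free_bd n.+1 u) = 0.
Proof.
apply: (@malg_ext _ _ _ (free_bd n \o free_bd n.+1) \0) => x /=.
rewrite malg_liftU linear_sum.
under eq_bigr => i _ do rewrite linearZ /= malg_liftU scaler_sumr.
rewrite pair_big /=.
under eq_bigr => p _ do rewrite scalerA -exprD.
rewrite (bigID (fun p : 'I_n.+3 * 'I_n.+2 => (p.2 < p.1)%N)) /=.
pose h (p : 'I_n.+3 * 'I_n.+2) : 'I_n.+3 * 'I_n.+2 := (inord p.2.+1, inord p.1).
pose h' (p : 'I_n.+3 * 'I_n.+2) : 'I_n.+3 * 'I_n.+2 := (inord p.2, inord p.1.-1).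
rewrite [X in _ + X](reindex_onto h' h) /=; last first.
  move=> [i j] /=; rewrite -leqNgt => ij; rewrite /h /h' /=.
  congr pair; apply: val_inj; rewrite /= !inordK//; have := ltn_ord j; have := ltn_ord i; lia.
rewrite [X in _ + X](eq_bigl (fun p : 'I_n.+3 * 'I_n.+2 => (p.2 < p.1)%N)); last first.
  move=> [i j] /=; have := ltn_ord j; have := ltn_ord i => iL jL.
  rewrite /h' /= !inordK; try lia.
  apply/idP/idP => [/andP[ij /eqP e]|ji].
    have e1 : (inord (inord i.-1 : 'I_n.+2).+1 : 'I_n.+3) = i :> nat.
      by have := congr1 (fun p : 'I_n.+3 * 'I_n.+2 => nat_of_ord p.1) e.
    by move: e1; rewrite !inordK; lia.
  apply/andP; split; first by lia.
  by apply/eqP; congr pair; apply: val_inj; rewrite /= !inordK; lia.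
rewrite -big_split big1//= => -[i j] /= ji.
have := ltn_ord j; have := ltn_ord i => iL jL.
rewrite (@face_face _ i j (inord j) (inord i.-1)) ?inordK//; try lia.
rewrite -scalerDl (_ : (i + j)%N = (j + i.-1).+1); last by lia.
by rewrite exprS mulN1r addNr scale0r.
Qed.

Definition dgn n : submod (malg (nerve n) int) :=
  lspan [set u | exists2 x, degenerate x & u = mkmalgU x 1].

Lemma dgn_bd n u : u \in dgn n.+1 -> free_bd n u \in dgn n.
Proof.
apply: (@lspan_sub _ _ _ (preimm (free_bd n) (dgn n))) => _ [x /degenerateP[i iln xi] ->].
rewrite mem_preimm free_bdU.
have i1 : (i < n.+2)%N by lia.
have i2 : (i.+1 < n.+2)%N by lia.
rewrite (bigD1 (Ordinal i1))//= (bigD1 (Ordinal i2))/=; last first.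
  by rewrite -val_eqE /=; lia.
have -> : face (Ordinal i2) x = face (Ordinal i1) x.
  apply: nerve_ext => m mn; rewrite !faceE//=.
  have [->|mi] := eqVneq m i.
    have b1 : bump i.+1 i = i by rewrite /bump; lia.
    have b2 : bump i i = i.+1 by rewrite /bump; lia.
    by rewrite b1 b2.
  by congr (x (inord _)); rewrite /bump; lia.
rewrite addrA exprS mulN1r scaleNr subrr add0r.
rewrite -[X in is_true X]/(_ \in dgn n).
apply: rpred_sum => j /andP[ji1 ji2]; apply: rpredZ; apply: lspan_gen.
exists (face j x) => //; apply/degenerateP.
have {}ji1 : j <> i :> nat by move=> e; case/eqP: ji1; apply: val_inj.
have {}ji2 : j <> i.+1 :> nat by move=> e; case/eqP: ji2; apply: val_inj.
have jL := ltn_ord j.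
have [ji|ij] := ltnP j i.
  exists i.-1; first by lia.
  rewrite !faceE; try lia.
  have b1 : bump j i.-1 = i by rewrite /bump; lia.
  have b2 : bump j i.-1.+1 = i.+1 by rewrite /bump; lia.
  by rewrite b1 b2.
exists i; first by lia.
rewrite !faceE; try lia.
have b1 : bump j i = i by rewrite /bump; lia.
have b2 : bump j i.+1 = i.+1 by rewrite /bump; lia.
by rewrite b1 b2.
Qed.

Definition nchain_bd n : {linear quotm (dgn n.+1) -> quotm (dgn n)} :=
  qmap (@dgn_bd n).

Lemma nchain_bdK n x : nchain_bd n (nchain_bd n.+1 x) = 0.
Proof.
have [v ->] := qpi_surj x; rewrite /nchain_bd !qmapE free_bdK; exact: linear0.
Qed.

Definition nchain : complex int := Complex nchain_bdK.

Definition simplex n (x : nerve n) : nchain n := qpi (dgn n) (mkmalgU x 1).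

Lemma simplex_degenerate n (x : nerve n) : degenerate x -> simplex x = 0.
Proof. by move=> dx; apply: qpi0; apply: lspan_gen; exists x. Qed.

Lemma bd_simplex n (x : nerve n.+1) :
  bd nchain n (simplex x) = \sum_(i < n.+2) (-1) ^+ i *: simplex (face i x).
Proof.
rewrite [LHS]qmapE free_bdU linear_sum; apply: eq_bigr => i _.
exact: linearZ.
Qed.

Definition filt (l : {nonneg R}) n : submod (nchain n) :=
  lspan [set u | exists x : nerve n,
    [/\ ~ degenerate x, (len x <= l%:num%:E)%E & u = simplex x]].

Lemma filt_bd l n u : u \in filt l n.+1 -> bd nchain n u \in filt l n.
Proof.
apply: (@lspan_sub _ _ _ (preimm (bd nchain n) (filt l n))) => _ [x [_ xl ->]].
rewrite mem_preimm bd_simplex.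
apply: rpred_sum => i _; apply: rpredZ.
have [/simplex_degenerate->|nd] := pselect (degenerate (face i x)).
  exact: rpred0.
by apply: lspan_gen; exists (face i x); split=> //; apply: le_trans xl; exact: len_face.
Qed.

Definition Fle (l : {nonneg R}) : subcomplex nchain := Subcomplex (@filt_bd l).

Lemma FleS (l l' : {nonneg R}) : l <= l' ->
  forall n x, x \in Fle l n -> x \in Fle l' n.
Proof.
move=> ll' n; apply: lspan_sub => _ [x [nd xl ->]]; apply: lspan_gen; exists x.
by split=> //; apply: le_trans xl _; rewrite lee_fin.
Qed.

(* The union of the [Fle l'] for [l' < l]; the empty union is zero. *)
Lemma filt_lt_closed l n :
  submod_closed (fun u : nchain n =>
    `[< u = 0 \/ exists2 l', l' < l & u \in Fle l' n >]).
Proof.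
split; first by apply/asboolP; left.
move=> a u v /asboolP[->|[s sl us]] /asboolP[->|[t tl vt]]; apply/asboolP.
- by left; rewrite scaler0 addr0.
- by right; exists t => //; rewrite scaler0 add0r.
- by right; exists s => //; rewrite addr0 rpredZ.
- right; have [st|/ltW ts] := leP s t.
    by exists t => //; rewrite rpredD ?rpredZ// (FleS st).
  by exists s => //; rewrite rpredD ?rpredZ// (FleS ts).
Qed.

Lemma filt_lt_bd l n u : u \in Submod (filt_lt_closed l n.+1) ->
  bd nchain n u \in Submod (filt_lt_closed l n).
Proof.
move=> /asboolP[->|[s sl us]]; apply/asboolP; first by left; rewrite linear0.
by right; exists s => //; exact: sub_bd.
Qed.

Definition Flt (l : {nonneg R}) : subcomplex nchain := Subcomplex (@filt_lt_bd l).

Lemma Flt_Fle l n x : x \in Flt l n -> x \in Fle l n.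
Proof. by move=> /asboolP[->|[s /ltW sl]]; [exact: rpred0|exact: FleS]. Qed.

Definition MC (l : {nonneg R}) : complex int := quotcx (restr (Flt l) (Fle l)).

Definition MH (n : nat) (l : {nonneg R}) : lmodType int := homology (MC l) n.

Definition MHF (F : fieldType) (n : nat) (l : {nonneg R}) : lmodType F :=
  homology (tensorcx F (MC l)) n.

End LengthNerve.

Record persmod (R : realType) (k : nzRingType) := PersMod {
  pm_ob :> {nonneg R} -> lmodType k;
  pm_map : forall s t : {nonneg R}, s <= t -> {linear pm_ob s -> pm_ob t};
  pm_id : forall s (ss : s <= s) x, pm_map ss x = x;
  pm_comp : forall r s t (rs : r <= s) (st : s <= t) (rt : r <= t) x,
    pm_map rt x = pm_map st (pm_map rs x) }.

Arguments pm_map {R k} M {s t} st : rename.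

Section PersistenceModules.
Variables (R : realType) (k : nzRingType).

Definition persmod_iso (M N : persmod R k) : Prop :=
  exists f : forall l, {linear M l -> N l},
    (forall l, bijective (f l)) /\
    (forall s t (st : s <= t) x, f t (pm_map M st x) = pm_map N st (f s x)).

Section Colimit.
Variables (M : persmod R k) (l : {nonneg R}).

Definition param_below : choiceType := {s : {nonneg R} | s < l}.

Let Mb (s : param_below) : lmodType k := M (val s).

Definition colim_rel : set (dsum Mb) :=
  [set u | exists (s t : param_below) (st : val s <= val t) (x : M (val s)),
     u = @dsum_inj k param_below Mb s x - @dsum_inj k param_below Mb t (pm_map M st x)].

(* The colimit of the [M s] over [s < l], as a quotient of their direct sum;
   for [l = 0] the sum is empty and the colimit is zero. *)
Definition colim_below : lmodType k := quotm (lspan colim_rel).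

Definition colim_cocone : {linear dsum Mb -> M l} :=
  dsum_lift (fun s : param_below => pm_map M (ltW (valP s))).

Lemma colim_coconeP u : u \in lspan colim_rel -> colim_cocone u = 0.
Proof.
move=> uS; apply/eqP; move: u uS.
apply: (@lspan_sub _ _ _ (kerm colim_cocone)) => _ [s [t [st [x ->]]]].
change (colim_cocone (@dsum_inj k param_below Mb s x
  - @dsum_inj k param_below Mb t (pm_map M st x)) == 0).
rewrite linearB /= !dsum_lift_inj subr_eq0; apply/eqP; exact: pm_comp.
Qed.

Definition colim_map : {linear colim_below -> M l} := qlift colim_coconeP.
End Colimit.

Section DirectSumPersMod.
Variables (I : choiceType) (M : I -> persmod R k).

Definition dsum_pm_ob l : lmodType k := dsum (fun i => M i l).
Definition dsum_pm_map (s t : {nonneg R}) (st : s <= t) :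
    {linear dsum_pm_ob s -> dsum_pm_ob t} :=
  dsum_map (fun i => pm_map (M i) st).

Lemma dsum_pm_id s (ss : s <= s) x : dsum_pm_map ss x = x.
Proof.
apply: val_inj; apply: functional_extensionality_dep => i; exact: pm_id.
Qed.
Lemma dsum_pm_comp r s t (rs : r <= s) (st : s <= t) (rt : r <= t) x :
  dsum_pm_map rt x = dsum_pm_map st (dsum_pm_map rs x).
Proof.
apply: val_inj; apply: functional_extensionality_dep => i; exact: pm_comp.
Qed.
Definition dsum_persmod : persmod R k := PersMod dsum_pm_id dsum_pm_comp.
End DirectSumPersMod.
End PersistenceModules.

Record nng_interval (R : realType) := NngInterval {
  itv_set :> set R;
  itv_ge0 : itv_set `<=` `[0, +oo[;
  itv_neq0 : itv_set !=set0;
  itv_convex : forall x y z, itv_set x -> itv_set z -> x <= y <= z -> itv_set y }.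

Section IntervalModule.
Variables (R : realType) (F : fieldType) (J : nng_interval R).

Lemma itvmod_closed (l : {nonneg R}) :
  submod_closed (fun c : F^o => `[< ~ itv_set J l%:num -> c = 0 >]).
Proof.
split; first exact/asboolP.
move=> a u v /asboolP u0 /asboolP v0; apply/asboolP => Jl.
by rewrite u0// v0// scaler0 addr0.
Qed.

(* All of [F] when [l] belongs to [J], the zero submodule of [F] otherwise. *)
Definition itvmod_ob (l : {nonneg R}) : lmodType F := subm (Submod (itvmod_closed l)).

Definition itvmod_fun (t : {nonneg R}) (c : F^o) : F^o :=
  if `[< itv_set J t%:num >] then c else 0.

Lemma itvmod_linear t : linear (itvmod_fun t).
Proof.
by move=> a u v; rewrite /itvmod_fun; case: ifP => // _; rewrite scaler0 addr0.
Qed.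
HB.instance Definition _ t :=
  GRing.isLinear.Build F F^o F^o *:%R (itvmod_fun t) (itvmod_linear t).

Lemma itvmod_funP s t c : c \in Submod (itvmod_closed s) ->
  itvmod_fun t c \in Submod (itvmod_closed t).
Proof.
by move=> _; apply/asboolP; rewrite /itvmod_fun; case: asboolP.
Qed.

Definition itvmod_map (s t : {nonneg R}) (st : s <= t) :
  {linear itvmod_ob s -> itvmod_ob t} := smap (@itvmod_funP s t).

Lemma itvmod_id s (ss : s <= s) x : itvmod_map ss x = x.
Proof.
apply: val_inj; rewrite /= /itvmod_fun; case: asboolP => // nJ.
by have /asboolP -> := subm_valP x.
Qed.

Lemma itvmod_comp r s t (rs : r <= s) (st : s <= t) (rt : r <= t) x :
  itvmod_map rt x = itvmod_map st (itvmod_map rs x).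
Proof.
apply: val_inj; rewrite /= /itvmod_fun.
case: asboolP => // Jt; case: asboolP => // nJs.
have /asboolP -> // := subm_valP x; move=> Jr; apply: nJs.
by apply: itv_convex Jr Jt _; apply/andP.
Qed.

Definition itvmod : persmod R F := PersMod itvmod_id itvmod_comp.
End IntervalModule.

Section Barcodes.
Variables (R : realType) (F : fieldType).

(* Multisets of intervals are represented as families [B : I -> nng_interval R].
   A pointwise finite-dimensional [M] determines [B] up to a bijection of [I]. *)
Definition is_barcode (I : choiceType) (B : I -> nng_interval R) (M : persmod R F) :
    Prop :=
  persmod_iso M (dsum_persmod (fun i => itvmod F (B i))).

Definition births (I : choiceType) (B : I -> nng_interval R) : set R :=
  [set x | exists i, x = inf (B i)].

Definition deaths (I : choiceType) (B : I -> nng_interval R) : set R :=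
  [set x | exists2 i, has_ubound (B i) & x = sup (B i)].
End Barcodes.

Section PersistentMagnitudeHomology.
Variables (R : realType) (X : extMetric R) (n : nat).

Definition PH_map (s t : {nonneg R}) (st : s <= t) :
    {linear homology (subcx (Fle X s)) n -> homology (subcx (Fle X t)) n} :=
  homology_map (incl (@FleS R X s t st)) n.

Lemma PH_id s (ss : s <= s) x : PH_map ss x = x.
Proof. by apply: homology_map_id => v; exact: val_inj. Qed.

Lemma PH_comp r s t (rs : r <= s) (st : s <= t) (rt : r <= t) x :
  PH_map rt x = PH_map st (PH_map rs x).
Proof. by apply: homology_map_comp => v; exact: val_inj. Qed.

Definition PH : persmod R int := PersMod PH_id PH_comp.

Variable F : fieldType.

Definition PHF_map (s t : {nonneg R}) (st : s <= t) :
    {linear homology (tensorcx F (subcx (Fle X s))) n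
       -> homology (tensorcx F (subcx (Fle X t))) n} :=
  homology_map (tensorcx_map F (incl (@FleS R X s t st))) n.

Lemma PHF_id s (ss : s <= s) x : PHF_map ss x = x.
Proof.
by apply: homology_map_id; apply: tensor_map_id => v; exact: val_inj.
Qed.

Lemma PHF_comp r s t (rs : r <= s) (st : s <= t) (rt : r <= t) x :
  PHF_map rt x = PHF_map st (PHF_map rs x).
Proof.
by apply: homology_map_comp; apply: tensor_map_comp => v; exact: val_inj.
Qed.

Definition PHF : persmod R F := PersMod PHF_id PHF_comp.
End PersistentMagnitudeHomology.

(* Main.v *)
Require Import Defs.
From HB Require Import structures.
From mathcomp Require Import all_boot all_order all_algebra.
From mathcomp Require Import interval_inference finmap all_classical all_reals.
From mathcomp Require Import lra.
(* The notations of monalg clash with those of classical. *)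
From mathcomp Require Import -(notations) monalg.

Set Implicit Arguments.
Unset Strict Implicit.
Unset Printing Implicit Defensive.

Import Order.TTheory GRing.Theory Num.Theory.

Local Open Scope classical_set_scope.
Local Open Scope ring_scope.

(* The sequence 0 -> F_{<l} C -> F_l C -> MC_l -> 0 is split exact in each
   degree, the retraction truncating chains to the simplices of length < l, so
   it stays exact after tensoring with a field.  If the homology of MC_l
   vanishes in degrees n and n+1, the long exact sequence makes
   H_n(F_{<l} C) -> H_n(F_l C) bijective; and H_n(F_{<l} C) is the colimit of
   the H_n(F_s C), s < l, because a chain and a bounding chain live in some F_s.
   For finite X only finitely many lengths occur in degrees <= n+1.  Hence
   PH_n is constant on some [l, t], l < t, which forces every bar to contain its
   infimum and not its supremum; and when the magnitude homology vanishes at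
   l > 0, PH_n is constant on some [s, l], so no bar begins or ends at l. *)

Lemma inj_surj_bij (S T : Type) (f : S -> T) :
  injective f -> (forall y, exists x, y = f x) -> bijective f.
Proof.
move=> finj fsurj; pose g y := sval (cid (fsurj y)).
have gK : cancel g f by move=> y; rewrite /g; case: cid.
by exists g => // x; apply: finj.
Qed.

Lemma bij_surj (S T : Type) (f : S -> T) :
  bijective f -> forall y, exists x, y = f x.
Proof. by move=> [g _ gK] y; exists (g y). Qed.

(** * Relative vanishing and homology *)

Section Homology.
Variable k : nzRingType.

Lemma linear_inj (V W : lmodType k) (f : {linear V -> W}) :
  (forall x, f x = 0 -> x = 0) -> injective f.
Proof.
move=> f0 x y fxy; apply/eqP; rewrite -subr_eq0; apply/eqP/f0.
by rewrite linearB fxy subrr.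
Qed.

Lemma linear_lspan0 (V W : lmodType k) (f : {linear V -> W}) (G : set V) :
  (forall g, G g -> f g = 0) -> forall v, v \in lspan G -> f v = 0.
Proof.
move=> fG v vG; apply/eqP; change (v \in kerm f); move: v vG.
by apply: lspan_sub => g /fG fg0; apply/eqP.
Qed.

Lemma homology0P (C : complex k) n (z : subm (cycles C n)) :
  qpi (preimm (@subm_val k (C n) (cycles C n)) (boundaries C n)) z = 0
  <-> exists w, subm_val z = bd C n w.
Proof.
rewrite -[0](linear0 (qpi _)); rewrite qpiP subr0 mem_preimm.
by split=> /asboolP.
Qed.

Lemma bd_cycle (C : complex k) n w : bd C n w \in cycles C n.
Proof. by case: n w => [//|n] w; apply/eqP; exact: bdK. Qed.

Lemma trivial_homologyP (C : complex k) n : is_trivial (homology C n) ->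
  forall z, z \in cycles C n -> exists w, z = bd C n w.
Proof.
by move=> H0 z zC; apply: (proj1 (homology0P (Subm zC))); exact: H0.
Qed.

(** Injectivity one degree lower detects whether a boundary vanishes. Writing [n.-1] lets one
    statement cover [n = 0], where every chain is a cycle. *)
Lemma cycle_reflect (C D : complex k) (f : chain_map C D) n :
  injective (f n.-1) -> forall z, f n z \in cycles D n -> z \in cycles C n.
Proof.
case: n => [//|n] /= finj z /eqP fz0; apply/eqP; apply: finj.
by rewrite cmapK fz0 linear0.
Qed.

(* The last two hypotheses say that the relative homology of [f] vanishes
   in degrees [n] and [n.+1]. *)
Lemma homology_map_bij (C D : complex k) (f : chain_map C D) n :
  injective (f n.-1) -> injective (f n) ->
  (forall z, z \in cycles D n -> exists w a, z = bd D n w + f n a) ->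
  (forall w a, bd D n w = f n a -> exists v b, w = bd D n.+1 v + f n.+1 b) ->
  bijective (homology_map f n).
Proof.
move=> inj1 inj0 reln reln1; apply: inj_surj_bij.
  apply: linear_inj => x; have [z ->] := qpi_surj x.
  rewrite homology_mapE => /homology0P[w /= fz].
  have [v [b wE]] := reln1 _ _ (esym fz).
  apply/homology0P; exists b; apply: inj0.
  by rewrite fz wE linearD bdK add0r cmapK.
move=> y; have [z ->] := qpi_surj y.
have [w [a zE]] := reln _ (subm_valP z).
have aC : a \in cycles C n.
  apply: (cycle_reflect inj1); rewrite (_ : f n a = subm_val z - bd D n w).
    by rewrite rpredB// ?bd_cycle// subm_valP.
  by rewrite zE addrC addKr.
exists (qpi _ (Subm aC)); rewrite homology_mapE; apply/qpiP.
by apply/asboolP; exists w; rewrite /= zE addrK.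
Qed.

(** Homology in degree [n] sees the complex only up to degree [n.+1]; this bound later lets finitely
    many lengths suffice. *)
Lemma homology_map_bij_deg (C D : complex k) (f : chain_map C D) n :
  (forall m, (m <= n.+1)%N -> bijective (f m)) -> bijective (homology_map f n).
Proof.
move=> fbij; apply: homology_map_bij.
- by apply/bij_inj/fbij; rewrite (leq_trans (leq_pred n)).
- exact/bij_inj/fbij.
- move=> z _; have [a ->] := bij_surj (fbij n (leqnSn n)) z.
  by exists 0, a; rewrite linear0 add0r.
- move=> w a _; have [b ->] := bij_surj (fbij n.+1 (leqnn _)) w.
  by exists 0, b; rewrite linear0 add0r.
Qed.

(** The piece of the long exact sequence between the two vanishing groups: exactness in [Q] supplies
    the relative vanishing that [homology_map_bij] asks for. *)
Lemma homology_map_bij_ses (A B Q : complex k)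
    (f : chain_map A B) (g : chain_map B Q) n :
  (forall m, injective (f m)) -> (forall m a, g m (f m a) = 0) ->
  (forall m b, g m b = 0 -> exists a, b = f m a) ->
  (forall m q, exists b, q = g m b) ->
  is_trivial (homology Q n) -> is_trivial (homology Q n.+1) ->
  bijective (homology_map f n).
Proof.
move=> finj gf kerg gsurj /trivial_homologyP Hn /trivial_homologyP Hn1.
(* A boundary in [Q] lifts to a boundary in [B]; the error lies in the kernel of [g], hence in the
   image of [f]. *)
have lift m b w : g m b = bd Q m w ->
    exists w' a, b = bd B m w' + f m a.
  have [w' ->] := gsurj _ w; rewrite -cmapK => E.
  have [|a bE] := kerg m (b - bd B m w'); first by rewrite linearB E subrr.
  by exists w', a; rewrite -bE addrC subrK.
apply: homology_map_bij => //.
- move=> z zB; have [w zE] := Hn (g n z) (cmap_cycles g zB); exact: lift zE.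
- move=> w a wa; have [|v wE] := Hn1 (g n.+1 w); last exact: lift wE.
  by apply/eqP; rewrite -cmapK wa gf.
Qed.
End Homology.

(** * Exactness of base change *)

Section Tensor.
Variable k : nzRingType.

Lemma tensor_map_cancel (A B : lmodType int) (f : {linear A -> B})
    (g : {linear B -> A}) :
  cancel f g -> cancel (tensor_map k f) (tensor_map k g).
Proof.
move=> fK x; rewrite -(@tensor_map_comp _ _ _ _ _ _ (g \o f))//.
exact: tensor_map_id.
Qed.

(** The projection to the cokernel kills all pure tensors, and these determine a linear map on a
    tensor product. *)
Lemma tensor_map_surj (A B : lmodType int) (f : {linear A -> B}) :
  (forall b, exists a, b = f a) -> forall y, exists x, y = tensor_map k f x.
Proof.
move=> fsurj y; pose S := imm (tensor_map k f).
suff S0 : qpi S =1 \0.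
  have : qpi S y = 0 by rewrite S0.
  rewrite -[0](linear0 (qpi S)) => /qpiP; rewrite subr0 => /asboolP[x yE].
  by exists x.
apply: tensor_ext => b /=; apply: qpi0; apply/asboolP.
have [a ->] := fsurj b; exists (qpi _ (mkmalgU a 1)).
by rewrite tensor_mapE.
Qed.

(** Right exactness: the projection to the cokernel of [tensor_map k f] factors through
    [tensor_map k g], so it kills [y]. *)
Lemma tensor_map_exact (A B C : lmodType int) (f : {linear A -> B})
    (g : {linear B -> C}) :
  (forall c, exists b, c = g b) -> (forall b, g b = 0 -> exists a, b = f a) ->
  forall y, tensor_map k g y = 0 -> exists x, y = tensor_map k f x.
Proof.
move=> gsurj kerg y gy0; pose S := imm (tensor_map k f).
pose pt b : tensor k B := qpi _ (mkmalgU b 1).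
have ptD a b : pt (a + b) = pt a + pt b.
  apply/eqP; rewrite -subr_eq0 opprD addrA /pt -!linearB; apply/eqP/qpi0.
  by apply: lspan_gen; exists a, b.
have ptS b : g b = 0 -> pt b \in S.
  move=> /kerg[a ->]; apply/asboolP; exists (qpi _ (mkmalgU a 1)).
  by rewrite tensor_mapE.
(* A set-theoretic section of [g], which need not be additive. *)
pose r c := sval (cid (gsurj c)).
have rK c : g (r c) = c by rewrite /r; case: cid.
(* Modulo [S] the choice of a lift does not matter, because two lifts differ by an element of the
   image of [f]. *)
have qr b : qpi S (pt (r (g b))) = qpi S (pt b).
  apply/qpiP; rewrite (_ : _ - _ = pt (r (g b) - b)).
    by apply: ptS; rewrite linearB rK subrr.
  by apply/eqP; rewrite subr_eq -ptD subrK.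
have [h hE] : exists h : {linear malg C k -> quotm S},
    forall c, h (mkmalgU c 1) = qpi S (pt (r c)).
  by exists (malg_lift (fun c => qpi S (pt (r c)))); exact: malg_liftU.
(* Independence of the lift restores additivity: lifts of [a] and [b] add up to a lift of
   [a + b]. *)
have h0 u : u \in lspan (@tensor_rel k C) -> h u = 0.
  apply: linear_lspan0 => _ [a [b ->]].
  rewrite !linearB /= !hE.
  have [a' ->] := gsurj a; have [b' ->] := gsurj b.
  by rewrite -(linearD g) !qr ptD linearD -addrA -opprD subrr.
have hg : qlift h0 \o tensor_map k g =1 qpi S.
  apply: tensor_ext => b.
  transitivity (qlift h0 (qpi _ (mkmalgU (g b) 1))).
    exact: (congr1 (qlift h0) (tensor_mapE k g b)).
  by rewrite qliftE hE qr.
have : qpi S y = 0 by rewrite -(hg y) [LHS](congr1 (qlift h0) gy0) linear0.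
by rewrite -[X in _ = X](linear0 (qpi S)) => /qpiP; rewrite subr0 => /asboolP.
Qed.
End Tensor.

(** * The sequence [Flt -> Fle -> MC] *)

Section Truncation.
Variables (R : realType) (X : extMetric R) (l : {nonneg R}).

Definition trunc_simplex n (x : nerve X n) : nchain X n :=
  if `[< ~ degenerate x /\ (len x < l%:num%:E)%E >] then simplex x else 0.

Lemma trunc_degenerate n u :
  u \in dgn X n -> malg_lift (@trunc_simplex n) u = 0.
Proof.
apply: linear_lspan0 => _ [x dx ->].
by rewrite [LHS]malg_liftU /trunc_simplex; case: asboolP => // -[].
Qed.

(** A retraction in each degree separately: it need not commute with the differential, since a face
    can be shorter than its simplex. *)
Definition trunc n : {linear nchain X n -> nchain X n} :=
  qlift (@trunc_degenerate n).

Lemma trunc_simplexE n (x : nerve X n) : trunc n (simplex x) = trunc_simplex x.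
Proof. by rewrite [LHS]qliftE [LHS]malg_liftU. Qed.

(** The length itself serves as the level [s < l]: being below [l] makes it finite. *)
Lemma simplex_Flt n (x : nerve X n) :
  (len x < l%:num%:E)%E -> ~ degenerate x -> simplex x \in Flt X l n.
Proof.
move=> xl nd; apply/asboolP; right.
have xfin : (len x \is a fin_num)%E.
  by rewrite ge0_fin_numE ?len_ge0// (lt_le_trans xl) ?leey.
pose s := NngNum (fine_ge0 (len_ge0 x)).
have lenE : len x = s%:num%:E by rewrite /= fineK.
exists s; first by rewrite -num_lt -lte_fin -lenE.
by apply: lspan_gen; exists x; split=> //; rewrite lenE.
Qed.

Lemma trunc_Flt n u : trunc n u \in Flt X l n.
Proof.
have [v ->] := qpi_surj u; rewrite [X in X \in _]qliftE.
rewrite rpred_sum// => x _; rewrite rpredZ// /trunc_simplex.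
by case: asboolP => [[]|_]; rewrite ?rpred0//; move=> *; exact: simplex_Flt.
Qed.

Lemma trunc_id n u : u \in Flt X l n -> trunc n u = u.
Proof.
move=> /asboolP[->|[s sl us]]; first by rewrite linear0.
apply/eqP; rewrite -subr_eq0; apply/eqP; move: u us.
apply: (@linear_lspan0 _ _ _ (trunc n \- idfun)%R) => _ [x [nd xs ->]].
rewrite [LHS](congr1 (fun y => y - simplex x) (trunc_simplexE x)).
rewrite /trunc_simplex asboolT ?subrr//.
by split=> //; apply: le_lt_trans xs _; rewrite lte_fin num_lt.
Qed.

Lemma trunc_FleFlt n u : u \in Fle X l n -> trunc n u \in Flt X l n.
Proof. by move=> _; exact: trunc_Flt. Qed.

Definition Fle_Flt n : {linear subcx (Fle X l) n -> subcx (Flt X l) n} :=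
  smap (@trunc_FleFlt n).

Definition Flt_incl := Defs.incl (@Flt_Fle R X l).

Lemma Flt_inclK n : cancel (Flt_incl n) (Fle_Flt n).
Proof. by move=> u; apply: val_inj; exact: trunc_id (subm_valP u). Qed.

Definition MC_proj_map n : {linear subcx (Fle X l) n -> MC X l n} :=
  qpi (restr (Flt X l) (Fle X l) n).

Lemma MC_proj_mapK n x :
  MC_proj_map n (bd (subcx (Fle X l)) n x) = bd (MC X l) n (MC_proj_map n.+1 x).
Proof. by rewrite [RHS]qmapE. Qed.

Definition MC_proj : chain_map (subcx (Fle X l)) (MC X l) :=
  ChainMap MC_proj_mapK.

Lemma MC_proj_incl n a : MC_proj n (Flt_incl n a) = 0.
Proof. by apply: qpi0; exact: (subm_valP a). Qed.

Lemma MC_proj_ker n b : MC_proj n b = 0 -> exists a, b = Flt_incl n a.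
Proof.
rewrite -[X in _ = X](linear0 (MC_proj n)) => /qpiP; rewrite subr0 => bS.
by exists (Subm (bS : subm_val b \in Flt X l n)); apply: val_inj.
Qed.

Lemma MC_proj_surj n q : exists b, q = MC_proj n b.
Proof. exact: qpi_surj. Qed.

Lemma Flt_homology n :
  is_trivial (MH X n l) -> is_trivial (MH X n.+1 l) ->
  bijective (homology_map Flt_incl n).
Proof.
apply: (@homology_map_bij_ses _ _ _ _ _ MC_proj).
- by move=> m; exact: can_inj (@Flt_inclK m).
- exact: MC_proj_incl.
- exact: MC_proj_ker.
- exact: MC_proj_surj.
Qed.

(** The retraction [Fle_Flt] keeps the inclusion injective after tensoring; the rest is right
    exactness of the tensor product. *)
Lemma Flt_homologyF (F : fieldType) n :
  is_trivial (MHF X F n l) -> is_trivial (MHF X F n.+1 l) ->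
  bijective (homology_map (tensorcx_map F Flt_incl) n).
Proof.
apply: (@homology_map_bij_ses _ _ _ _ _ (tensorcx_map F MC_proj)).
- by move=> m; exact: can_inj (tensor_map_cancel (@Flt_inclK m)).
- move=> m a; 
  transitivity (tensor_map F (MC_proj m \o Flt_incl m) a).
    exact/esym/tensor_map_comp.
  by apply: tensor_map_zero => b; exact: MC_proj_incl.
- move=> m; apply: tensor_map_exact; first exact: MC_proj_surj.
  exact: MC_proj_ker.
- by move=> m; apply: tensor_map_surj; exact: MC_proj_surj.
Qed.
End Truncation.

(** * The colimit from the left *)

Section DirectSum.
Variables (k : nzRingType) (I : choiceType).
Implicit Types V W : I -> lmodType k.

Lemma dsum_ext V (x y : dsum V) :
  (forall i, dsum_fun x i = dsum_fun y i) -> x = y.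
Proof. by move=> xy; apply: val_inj; exact: functional_extensionality_dep. Qed.

Lemma dsum_fun_inj V i (v : V i) : dsum_fun (dsum_inj v) i = v.
Proof.
rewrite /dsum_fun /= /dprod_inj; case: eqP => // ii.
by rewrite (Prop_irrelevance ii erefl).
Qed.

Lemma dsum_fun_inj_neq V i j (v : V i) : i <> j -> dsum_fun (dsum_inj v) j = 0.
Proof. by rewrite /dsum_fun /= /dprod_inj; case: eqP. Qed.

Lemma dsum_inj_linear V i : linear (@dsum_inj k I V i).
Proof.
move=> a u v; apply: dsum_ext => j.
rewrite [RHS](_ : _ = a *: dsum_fun (dsum_inj u) j + dsum_fun (dsum_inj v) j)//.
have [ij|ij] := pselect (i = j).
  by case: _ / ij; rewrite !dsum_fun_inj.
by rewrite !dsum_fun_inj_neq// scaler0 addr0.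
Qed.
HB.instance Definition _ V i :=
  GRing.isLinear.Build k (V i) (dsum V) *:%R (@dsum_inj k I V i)
    (@dsum_inj_linear V i).

Lemma dsum_map_inj V W (f : forall i, {linear V i -> W i}) i (v : V i) :
  dsum_map f (dsum_inj v) = dsum_inj (f i v).
Proof.
apply: dsum_ext => j; rewrite [LHS](_ : _ = f j (dsum_fun (dsum_inj v) j))//.
have [ij|ij] := pselect (i = j).
  by case: _ / ij; rewrite !dsum_fun_inj.
by rewrite !dsum_fun_inj_neq// linear0.
Qed.

(** Each summand is a retract of the direct sum, compatibly with [dsum_map]. This carries
    bijectivity of transition maps over to single bars. *)
Lemma dsum_map_bij V W (f : forall i, {linear V i -> W i}) i :
  bijective (dsum_map f) -> bijective (f i).
Proof.
move=> fbij; apply: inj_surj_bij => [|y].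
  apply: linear_inj => x fx0.
  rewrite -(dsum_fun_inj x) (_ : dsum_inj x = 0)//.
  by apply: (bij_inj fbij); rewrite dsum_map_inj fx0 !linear0.
have [x xE] := bij_surj fbij (dsum_inj y).
by exists (dsum_fun x i); rewrite -[LHS]dsum_fun_inj xE.
Qed.

Lemma dsum_decomp V (x : dsum V) (d : {fset I}) :
  (forall i, dsum_fun x i != 0 -> i \in d) ->
  x = \sum_(i <- d) dsum_inj (dsum_fun x i).
Proof.
move=> xd; apply: dsum_ext => j.
pose ev (u : dsum V) := dsum_fun u j.
rewrite -[RHS]/(ev _) (big_morph ev (id1 := 0) (op1 := +%R))//.
have [jd|jd] := boolP (j \in d).
  rewrite (big_fsetD1 j)//= big1_fset ?addr0 => [|i].
    exact/esym/dsum_fun_inj.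
  rewrite !inE => /andP[ij _] _; apply: dsum_fun_inj_neq; exact/eqP.
rewrite big1_fset => [|i id _]; last first.
  by apply: dsum_fun_inj_neq => ij; move: id; rewrite ij (negbTE jd).
by apply/eqP; apply: contraNT jd; exact: xd.
Qed.
End DirectSum.

Section Colimit.
Variables (R : realType) (k : nzRingType) (M : persmod R k) (l : {nonneg R}).

Let Mb (s : param_below l) : lmodType k := M (val s).
Let colim_pi : {linear dsum Mb -> colim_below M l} :=
  qpi (lspan (@colim_rel R k M l)).

Definition colim_in (s : param_below l) :
    {linear M (val s) -> colim_below M l} :=
  colim_pi \o (dsum_inj (i:=s) : {linear Mb s -> dsum Mb}).

Lemma colim_in_map (s t : param_below l) (st : val s <= val t) x :
  colim_in t (pm_map M st x) = colim_in s x.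
Proof. by apply/esym/qpiP/lspan_gen; exists s, t, st, x. Qed.

Lemma colim_map_in s x :
  colim_map M l (colim_in s x) = pm_map M (ltW (valP s)) x.
Proof. by rewrite [LHS]qliftE [LHS]dsum_lift_inj. Qed.

(** The parameters below [l] are totally ordered, so finitely many components can be pushed to the
    largest one and added there. The alternative [u = 0] is the empty sum, the only case when
    [l = 0]. *)
Lemma colim_in_surj (u : colim_below M l) :
  u = 0 \/ exists s x, u = colim_in s x.
Proof.
have [v ->] := qpi_surj u.
pose d := fset_set [set i | dsum_fun v i != 0].
have vd i : dsum_fun v i != 0 -> i \in d.
  by move=> vi; rewrite in_fset_set ?inE//; exact: dsum_fun_finite.
rewrite (dsum_decomp vd) linear_sum.
pose P (w : colim_below M l) := w = 0 \/ exists s x, w = colim_in s x.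
apply: (big_ind P); first by left.
  move=> _ _ [->|[s [x ->]]] [->|[t [y ->]]]; rewrite ?add0r ?addr0.
  - by left.
  - by right; exists t, y.
  - by right; exists s, x.
  right; have [st|/ltW ts] := leP (val s) (val t).
    by exists t, (pm_map M st x + y); rewrite linearD colim_in_map.
  by exists s, (x + pm_map M ts y); rewrite linearD colim_in_map.
by move=> i _; right; exists i, (dsum_fun v i).
Qed.
End Colimit.

Lemma incl_inj (k : nzRingType) (C : complex k) (A B : subcomplex C)
    (AB : forall n x, x \in A n -> x \in B n) n :
  injective (Defs.incl AB n).
Proof. by move=> x y /(congr1 (@subm_val _ _ _)) xy; apply: val_inj. Qed.

Section IntegralCase.
Variables (R : realType) (X : extMetric R) (l : {nonneg R}).

Lemma Fle_sub_Flt (s : {nonneg R}) : s < l ->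
  forall n x, x \in Fle X s n -> x \in Flt X l n.
Proof. by move=> sl n x xs; apply/asboolP; right; exists s. Qed.

(** The colimit is compared with the homology of [Flt]: a chain there, whether cycle or bounding
    chain, already lives at some level below [l]. *)
Lemma PH_colim_bij n : bijective (homology_map (Flt_incl X l) n) ->
  bijective (colim_map (PH X n) l).
Proof.
move=> Hbij; apply: inj_surj_bij.
  apply: linear_inj => u; have [->//|[s [x ->]]] := colim_in_surj u.
  rewrite colim_map_in => x0.
  have sl := valP s.
  have {}x0 : homology_map (Defs.incl (Fle_sub_Flt sl)) n x = 0.
    apply: (bij_inj Hbij); rewrite linear0 -[RHS]x0; apply/esym.
    apply: homology_map_comp => v; exact: val_inj.
  have [z xE] := qpi_surj x.
  move: x0; rewrite xE homology_mapE => /homology0P[w zw].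
  (* [t] is the larger of [s] and a level containing the bounding chain [w], or [s] itself if
     [w = 0]. *)
  have [t [st wt]] : exists t : param_below l,
      val s <= val t /\ subm_val w \in Fle X (val t) n.+1.
    have /asboolP[w0|[r rl wr]] := subm_valP w.
      by exists s; rewrite w0 rpred0.
    have [sr|/ltW rs] := leP (val s) r; first by exists (exist _ r rl).
    by exists s; split=> //; exact: FleS wr.
  rewrite -xE -(colim_in_map st).
  suff -> : pm_map (PH X n) st x = 0 by rewrite linear0.
  rewrite xE [LHS]homology_mapE; apply/homology0P; exists (Subm wt).
  by apply: val_inj; exact: (congr1 (@subm_val _ _ _) zw).
move=> y; have [y' ->] := bij_surj Hbij y; have [z ->] := qpi_surj y'.
have /asboolP[z0|[s sl zs]] := subm_valP (subm_val z).
  exists 0; rewrite linear0 (_ : z = 0) ?linear0//.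
  by apply: val_inj; apply: val_inj.
have zC : (Subm zs : subcx (Fle X s) n) \in cycles (subcx (Fle X s)) n.
  apply: (@cycle_reflect _ _ _ (Defs.incl (Fle_sub_Flt sl))).
    exact: incl_inj.
  rewrite [X in X \in _](_ : _ = subm_val z) ?subm_valP//.
  exact: val_inj.
exists (colim_in (PH X n) (exist _ s sl) (qpi _ (Subm zC))).
rewrite colim_map_in [RHS]homology_mapE homology_mapE; congr (qpi _ _).
by apply: val_inj; apply: val_inj.
Qed.
End IntegralCase.

(** * Finite spaces *)

Section FiniteGaps.
Variables (R : realType) (E : set (\bar R)).
Hypothesis Efin : finite_set E.

(** Induction on a list of the values: a finite value [r > l] is avoided by the midpoint of [l] and
    [r], and [+oo] exceeds every real [t]. *)
Lemma finite_gap_right (l : R) :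
  exists2 t, l < t & forall e, E e -> (e <= t%:E)%E -> (e <= l%:E)%E.
Proof.
have /finite_seqP[es ->] := Efin; elim: es => [|e es [t lt IH]].
  by exists (l + 1) => //; rewrite ltrDl.
have [el|le] := leP e l%:E.
  by exists t => // x /=; rewrite inE => /predU1P[->//|]; exact: IH.
case: e le => [r|_|//].
  rewrite lte_fin => lr; exists (Num.min t ((l + r) / 2)).
    by rewrite lt_min lt; lra.
  move=> x /=; rewrite inE => /predU1P[->|xes xt].
    by rewrite !lee_fin le_min => /andP[_]; lra.
  by apply: IH => //; apply: le_trans xt _; rewrite lee_fin ge_min lexx.
by exists t => // x /=; rewrite inE => /predU1P[->//|]; exact: IH.
Qed.

Lemma finite_gap_left (l : R) :
  exists2 s, s < l & forall e, E e -> (e < l%:E)%E -> (e <= s%:E)%E.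
Proof.
have /finite_seqP[es ->] := Efin; elim: es => [|e es [s sl IH]].
  by exists (l - 1) => //; rewrite ltrBlDr ltrDl.
have [le|el] := leP l%:E e.
  exists s => // x /=; rewrite inE => /predU1P[->|]; last exact: IH.
  by rewrite ltNge le.
case: e el => [r|//|_].
  rewrite lte_fin => rl; exists (Num.max s r); first by rewrite gt_max sl.
  move=> x /=; rewrite inE => /predU1P[->|xes xl].
    by rewrite lee_fin le_max lexx orbT.
  by apply: le_trans (IH _ xes xl) _; rewrite lee_fin le_max lexx.
exists s => // x /=; rewrite inE => /predU1P[->|]; last exact: IH.
by rewrite leNye.
Qed.
End FiniteGaps.

Lemma finite_nerve (R : realType) (X : extMetric R) n :
  finite_set [set: X] -> finite_set [set: nerve X n].
Proof.
move=> Xfin; pose D := fset_set [set: X].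
have XD x : x \in D by rewrite in_fset_set ?inE.
pose g (f : {ffun 'I_n.+1 -> D}) : nerve X n := [ffun i => val (f i)].
suff -> : [set: nerve X n] = g @` [set: {ffun 'I_n.+1 -> D}].
  by apply: finite_image; exact: finite_finset.
apply/seteqP; split=> // x _; exists [ffun i => [` XD (x i)]%fset] => //.
by apply/ffunP => i; rewrite !ffunE.
Qed.

(** * Local constancy of persistent homology over a field *)

Section FieldCase.
Variables (R : realType) (X : extMetric R) (n : nat) (F : fieldType).

Lemma Fle_stable (s t : {nonneg R}) m :
  (forall x : nerve X m, (len x <= t%:num%:E)%E -> (len x <= s%:num%:E)%E) ->
  forall u, u \in Fle X t m -> u \in Fle X s m.
Proof.
move=> ts; apply: lspan_sub => _ [x [nd /ts xs ->]].
by apply: lspan_gen; exists x.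
Qed.

Lemma Flt_stable (s l : {nonneg R}) m :
  (forall x : nerve X m, (len x < l%:num%:E)%E -> (len x <= s%:num%:E)%E) ->
  forall u, u \in Flt X l m -> u \in Fle X s m.
Proof.
move=> ls u /asboolP[->|[r rl]]; first exact: rpred0.
apply: Fle_stable => x xr; apply: ls; apply: le_lt_trans xr _.
by rewrite lte_fin num_lt.
Qed.

Lemma tensor_incl_bij (C : complex int) (A B : subcomplex C)
    (AB : forall m x, x \in A m -> x \in B m) :
  (forall m, (m <= n.+1)%N -> forall x, x \in B m -> x \in A m) ->
  bijective (homology_map (tensorcx_map F (Defs.incl AB)) n).
Proof.
move=> BA; apply: homology_map_bij_deg => m /BA BAm.
pose g : {linear subcx B m -> subcx A m} :=
  @smap _ _ _ (B m) (A m) idfun BAm.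
exists (tensor_map F g); apply: tensor_map_cancel => x; exact: val_inj.
Qed.

(** No tuple of degree at most [n.+1] has length in [(l, t]], so in these degrees the filtration
    does not change between [l] and [t]. *)
Lemma PHF_right : finite_set [set: X] -> forall l : {nonneg R},
  exists2 t : {nonneg R}, l < t &
    forall (u : {nonneg R}) (lu : l <= u), u <= t ->
      bijective (pm_map (PHF X n F) lu).
Proof.
move=> Xfin l; pose E := \bigcup_(m in `I_n.+2) range (@len R X m).
have Efin : finite_set E.
  apply: bigcup_finite => [|m _]; first exact: finite_II.
  exact/finite_image/finite_nerve.
have [t lt tE] := finite_gap_right Efin l%:num.
have t0 : 0 <= t by apply: le_trans (ltW lt).
exists (NngNum t0); first by rewrite -num_lt.
move=> u lu ut; apply: tensor_incl_bij => m mn; apply: Fle_stable => x xu.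
apply: tE; first by exists m => //; exists x.
by apply: le_trans xu _; rewrite lee_fin -[t]/((NngNum t0)%:num) num_le.
Qed.

(** The map from [u] to [l] factors through the homology of [Flt]: the absence of lengths in
    [(s, l)] makes the first factor bijective, vanishing magnitude homology the second. *)
Lemma PHF_left : finite_set [set: X] -> forall l : {nonneg R}, 0 < l%:num ->
  is_trivial (MHF X F n l) -> is_trivial (MHF X F n.+1 l) ->
  exists2 s : {nonneg R}, s < l &
    forall (u : {nonneg R}) (ul : u <= l), s <= u -> u < l ->
      bijective (pm_map (PHF X n F) ul).
Proof.
move=> Xfin l l0 Hn Hn1; pose E := \bigcup_(m in `I_n.+2) range (@len R X m).
have Efin : finite_set E.
  apply: bigcup_finite => [|m _]; first exact: finite_II.
  exact/finite_image/finite_nerve.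
have [r rl rE] := finite_gap_left Efin l%:num.
(* The gap bound [r] may be negative; the maximum with 0 stays below [l] because [l > 0]. *)
have s0 : 0 <= Num.max 0 r by rewrite le_max lexx.
exists (NngNum s0); first by rewrite -num_lt /= gt_max l0.
move=> u ul su u_lt_l.
pose f := tensorcx_map F (Defs.incl (@Fle_sub_Flt R X l u u_lt_l)).
have fbij : bijective (homology_map f n).
  apply: tensor_incl_bij => m mn; apply: Flt_stable => x xl.
  apply: (@le_trans _ _ r%:E).
    by apply: rE xl; exists m => //; exists x.
  rewrite lee_fin; apply: (@le_trans _ _ (NngNum s0)%:num).
    by rewrite /= le_max lexx orbT.
  by rewrite num_le.
pose g := homology_map (tensorcx_map F (Flt_incl X l)) n.
apply: (@eq_bij _ _ (g \o homology_map f n)).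
  exact: bij_comp (Flt_homologyF Hn Hn1) fbij.
move=> x; apply/esym/homology_map_comp.
by apply: tensor_map_comp => v; exact: val_inj.
Qed.

(** There is no level below 0, so [Flt] is the zero complex and the bijection makes the target
    vanish. *)
Lemma PHF_zero (l : {nonneg R}) : l%:num = 0 ->
  is_trivial (MHF X F n l) -> is_trivial (MHF X F n.+1 l) ->
  is_trivial (PHF X n F l).
Proof.
move=> l0 Hn Hn1 y; have [x ->] := bij_surj (Flt_homologyF Hn Hn1) y.
suff -> : x = 0 by rewrite linear0.
have [z ->] := qpi_surj x; suff -> : z = 0 by rewrite linear0.
apply: val_inj; move: (val z) => /= v.
have Flt0 (u : subcx (Flt X l) n) : u = 0.
  apply: val_inj; have /asboolP[//|[s sl]] := subm_valP u.
  by move: sl; rewrite -num_lt l0 ltNge ge0.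
(* On a zero group the identity is also the zero map, so its base change is both, and the tensor
   product is zero. *)
rewrite -[LHS](@tensor_map_id F (subcx (Flt X l) n) idfun (fun=> erefl)).
exact: tensor_map_zero.
Qed.
End FieldCase.

(** * Barcodes *)

Section Barcode.
Variables (R : realType) (F : fieldType).

Lemma persmod_iso_bij (M N : persmod R F) : persmod_iso M N ->
  forall (s t : {nonneg R}) (st : s <= t),
  bijective (pm_map M st) -> bijective (pm_map N st).
Proof.
move=> [f [fbij fM]] s t st Mbij; have [g gK fK] := fbij s.
apply: (@eq_bij _ _ (f t \o (pm_map M st \o g))).
  by do 2?[apply: bij_comp => //]; exists (f s).
by move=> x /=; rewrite fM fK.
Qed.

(** If [J] contained just one of the two parameters, the scalar 1 would be killed or missed. *)
Lemma itvmod_bij (J : nng_interval R) (s t : {nonneg R}) (st : s <= t) :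
  bijective (itvmod_map F J st) -> itv_set J s%:num <-> itv_set J t%:num.
Proof.
have mem1 r : itv_set J r%:num -> (1 : F^o) \in Submod (itvmod_closed F J r).
  by move=> Jr; apply/asboolP.
move=> Jbij; split=> [Js|Jt].
  apply: contrapT => nJt; pose x := Subm (mem1 s Js).
  have x0 : x = 0.
    apply: (bij_inj Jbij); rewrite linear0; apply: val_inj => /=.
    by rewrite /itvmod_fun asboolF.
  by have /eqP := congr1 (@subm_val _ _ _) x0; rewrite /= oner_eq0.
apply: contrapT => nJs; have [x xE] := bij_surj Jbij (Subm (mem1 t Jt)).
have /asboolP/(_ nJs) x0 := subm_valP x.
have /eqP := congr1 (@subm_val _ _ _) xE.
by rewrite /= /itvmod_fun asboolT// x0 oner_eq0.
Qed.

Variables (I : choiceType) (B : I -> nng_interval R) (M : persmod R F).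
Hypothesis BM : is_barcode B M.

Lemma barcode_bij (s t : {nonneg R}) (st : s <= t) i :
  bijective (pm_map M st) -> itv_set (B i) s%:num <-> itv_set (B i) t%:num.
Proof.
move=> /(persmod_iso_bij BM) Nbij; apply: itvmod_bij.
exact: (@dsum_map_bij _ _ _ _ (fun i => itvmod_map F (B i) st) i Nbij).
Qed.

(** The scalar 1 placed in summand [i] would be a nonzero element of a trivial space. *)
Lemma barcode_trivial (l : {nonneg R}) i :
  is_trivial (M l) -> ~ itv_set (B i) l%:num.
Proof.
move=> M0 Bl; have [f [fbij _]] := BM.
have mem1 : (1 : F^o) \in Submod (itvmod_closed F (B i) l) by apply/asboolP.
pose V i : lmodType F := itvmod F (B i) l.
pose x : V i := Subm mem1.
have [m mE] := bij_surj (fbij l) (@dsum_inj _ _ V i x).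
have x0 : x = 0 by rewrite -(dsum_fun_inj x) mE (M0 m) linear0.
by have /eqP := congr1 (@subm_val _ _ _) x0; rewrite /= oner_eq0.
Qed.
End Barcode.

(** * Endpoints of the bars for a finite space *)

Section BarcodeShape.
Variables (R : realType) (X : extMetric R) (n : nat) (F : fieldType).
Variables (I : choiceType) (B : I -> nng_interval R).
Hypothesis Xfin : finite_set [set: X].
Hypothesis BM : is_barcode B (PHF X n F).
Variable i : I.
Let J : set R := itv_set (B i).

Lemma bar_ge0 x : J x -> 0 <= x.
Proof. by move=> /itv_ge0; rewrite /= in_itv /= andbT. Qed.

Lemma bar_has_lbound : has_lbound J.
Proof. by exists 0 => x /bar_ge0. Qed.

Lemma bar_inf_ge0 : 0 <= inf J.
Proof. by apply: lb_le_inf; [exact: itv_neq0|move=> x /bar_ge0]. Qed.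

Lemma bar_right (x : R) : 0 <= x ->
  exists2 y, x < y & forall z, x <= z <= y -> J x <-> J z.
Proof.
move=> x0; have [t lt tbij] := PHF_right n F Xfin (NngNum x0).
exists t%:num; first by rewrite -num_lt in lt.
move=> z /andP[xz zt]; have z0 := le_trans x0 xz.
have xz' : NngNum x0 <= NngNum z0 by rewrite -num_le.
by apply: (barcode_bij BM (st := xz') i); apply: tbij; rewrite -num_le.
Qed.

(** Membership is constant just to the right of the infimum, and the bar meets every such right
    neighbourhood. *)
Lemma bar_inf_mem : J (inf J).
Proof.
have [y ly yJ] := bar_right bar_inf_ge0.
have [z Jz zy] := inf_lt (itv_neq0 (B i)) ly.
by apply/(yJ z) => //; rewrite (ge_inf bar_has_lbound Jz) ltW.
Qed.

(** If the supremum were attained, constancy to the right would put larger points in the bar. *)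
Lemma bar_sup_notin : has_ubound J -> ~ J (sup J).
Proof.
move=> ubJ Js; have [y sy yJ] := bar_right (bar_ge0 Js).
have /ub_le_sup : J y by apply/(yJ y) => //; rewrite lexx (ltW sy).
by move=> /(_ ubJ); rewrite leNgt sy.
Qed.

Lemma bar_shape :
  (exists b b' : R, J = `[b, b'[%classic) \/
  (exists b : R, J = `[b, +oo[%classic).
Proof.
have [ubJ|nubJ] := pselect (has_ubound J).
  left; exists (inf J), (sup J); apply/seteqP; split=> x /=; rewrite in_itv /=.
    move=> Jx; rewrite (ge_inf bar_has_lbound Jx) lt_neqAle ub_le_sup// andbT.
    by apply/eqP => xs; apply: (bar_sup_notin ubJ); rewrite -xs.
  move=> /andP[bx /(sup_gt (itv_neq0 (B i)))[y Jy xy]].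
  by apply: itv_convex bar_inf_mem Jy _; rewrite bx ltW.
right; exists (inf J); apply/seteqP; split=> x /=; rewrite in_itv /= andbT.
  by move=> Jx; rewrite (ge_inf bar_has_lbound Jx).
move=> bx; have [y Jy xy] : exists2 y, J y & x < y.
  apply: contrapT => xub; apply: nubJ; exists x => y Jy; rewrite leNgt.
  by apply/negP => xy; apply: xub; exists y.
by apply: itv_convex bar_inf_mem Jy _; rewrite bx ltW.
Qed.

Lemma bar_left (l : {nonneg R}) : 0 < l%:num ->
  is_trivial (MHF X F n l) -> is_trivial (MHF X F n.+1 l) ->
  exists2 s, s < l%:num &
    forall z, 0 <= z -> s <= z < l%:num -> J z <-> J l%:num.
Proof.
move=> l0 Hn Hn1; have [s sl sbij] := PHF_left Xfin l0 Hn Hn1.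
exists s%:num => // z z0 /andP[sz zl].
have zl' : NngNum z0 <= l by rewrite -num_le ltW.
apply: (barcode_bij BM (st := zl') i).
by apply: sbij; rewrite -?num_le -?num_lt.
Qed.

(** For [l = 0] the module vanishes at 0; for [l > 0] constancy from the left puts a point below the
    infimum into the bar. *)
Lemma bar_birth (l : {nonneg R}) : l%:num = inf J ->
  is_trivial (MHF X F n l) -> ~ is_trivial (MHF X F n.+1 l).
Proof.
move=> lJ Hn Hn1; have Jl : J l%:num by rewrite lJ; exact: bar_inf_mem.
have [l0|l0] := eqVneq l%:num 0.
  by have := barcode_trivial BM (PHF_zero l0 Hn Hn1) Jl.
have {}l0 : 0 < l%:num by rewrite lt0r l0 ge0.
have [s sl sJ] := bar_left l0 Hn Hn1.
have zl : Num.max 0 s < l%:num by rewrite gt_max l0.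
have /(ge_inf bar_has_lbound) : J (Num.max 0 s).
  by apply/sJ => //; rewrite ?le_max ?lexx ?orbT.
by rewrite -lJ leNgt zl.
Qed.

(** Points just left of the supremum lie in the bar while the supremum does not, against constancy
    from the left. *)
Lemma bar_death (l : {nonneg R}) : has_ubound J -> l%:num = sup J ->
  is_trivial (MHF X F n l) -> ~ is_trivial (MHF X F n.+1 l).
Proof.
move=> ubJ lJ Hn Hn1; have nJl : ~ J l%:num by rewrite lJ; exact: bar_sup_notin.
have bl : inf J < l%:num.
  rewrite lt_neqAle lJ ub_le_sup ?andbT//; last exact: bar_inf_mem.
  by apply/eqP => bs; apply: nJl; rewrite lJ -bs; exact: bar_inf_mem.
have [s sl sJ] := bar_left (le_lt_trans bar_inf_ge0 bl) Hn Hn1.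
(* This maximum is a point of [[s, l)] that lies in the bar by convexity. *)
have zl : Num.max s (inf J) < sup J by rewrite -lJ gt_max sl.
have [y Jy zy] := sup_gt (itv_neq0 (B i)) zl.
apply/nJl/(sJ (Num.max s (inf J))).
- by rewrite le_max bar_inf_ge0 orbT.
- by rewrite le_max lexx lJ.
- by apply: itv_convex bar_inf_mem Jy _; rewrite le_max lexx orbT ltW.
Qed.
End BarcodeShape.

Theorem corollary5p2 (R : realType) (X : extMetric R) (n : nat) :
  (forall l : {nonneg R},
     is_trivial (MH X n l) -> is_trivial (MH X n.+1 l) ->
     bijective (colim_map (PH X n) l))
  /\
  (finite_set [set: X] ->
   forall (F : fieldType) (I : choiceType) (B : I -> nng_interval R),
     is_barcode B (PHF X n F) ->
     (forall i, (exists b b' : R, B i = `[b, b'[%classic :> set R) \/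
                (exists b : R, B i = `[b, +oo[%classic :> set R))
     /\
     births B `|` deaths B `<=`
       (fun l : {nonneg R} => l%:num) @`
         ([set l | ~ is_trivial (MHF X F n l)] `|`
          [set l | ~ is_trivial (MHF X F n.+1 l)])).
Proof.
split=> [l Hn Hn1|Xfin F I B BM]; first exact/PH_colim_bij/Flt_homology.
split=> [i|x]; first exact: bar_shape Xfin BM i.
have or_notP (P Q : Prop) : (P -> ~ Q) -> ~ P \/ ~ Q.
  by move=> PQ; have [/PQ|] := pselect P; [right|left].
case=> [[i ->]|[i ubJ ->]].
  exists (NngNum (bar_inf_ge0 B i)) => //; apply: or_notP.
  exact: (bar_birth Xfin BM (l := NngNum (bar_inf_ge0 B i)) erefl).
have s0 : 0 <= sup (itv_set (B i)).
  apply: le_trans (bar_inf_ge0 B i) _; apply: ub_le_sup => //.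
  exact: bar_inf_mem Xfin BM i.
exists (NngNum s0) => //; apply: or_notP.
exact: (bar_death Xfin BM (l := NngNum s0) ubJ erefl).
Qed.
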